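(* Let $\mathbf s=s_1s_2\ldots$ be a Sturmian word over $\{a,b\}$, where $a,b$ are distinct positive integers, and let $\alpha=[0;s_1,s_2,\ldots]$. Then $\alpha$ has a L\'evy constant, i.e. the limit $\mathcal L(\alpha)=\lim_{n\to\infty}\frac1n\log Q_n(\alpha)$ exists (and is finite).
   Context: A Sturmian word over $\{a,b\}$ is a mechanical word of irrational slope $\theta\in[0,1]$: for some $0\le\rho<1$, either $s_n=a$ if $\lfloor n\theta+\rho\rfloor-\lfloor (n-1)\theta+\rho\rfloor=0$ and $s_n=b$ otherwise, or $s_n=a$ if $\lceil n\theta+\rho\rceil-\lceil (n-1)\theta+\rho\rceil=0$ and $s_n=b$ otherwise. $Q_n(\alpha)$ is the denominator of the $n$-th convergent $[0;s_1,\ldots,s_n]$ of $\alpha$. *)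

(* Defs.v *)
From HB Require Import structures.
From mathcomp Require Import all_boot all_order all_algebra.
From mathcomp Require Import all_classical all_reals all_analysis.

Set Implicit Arguments.
Unset Strict Implicit.
Unset Printing Implicit Defensive.

Import Order.TTheory GRing.Theory Num.Theory.
Import numFieldNormedType.Exports.

Local Open Scope classical_set_scope.
Local Open Scope ring_scope.

(* Words are indexed from 1, as s_1 s_2 ...; the value at 0 is never used. *)

Definition lower_mechanical (R : realType) (T : Type) (theta rho : R)
    (a b : T) (s : nat -> T) : Prop :=
  forall n : nat, (0 < n)%N ->
    s n = if Num.floor (n%:R * theta + rho)
             - Num.floor ((n%:R - 1) * theta + rho) == 0 then a else b.

Definition upper_mechanical (R : realType) (T : Type) (theta rho : R)
    (a b : T) (s : nat -> T) : Prop :=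
  forall n : nat, (0 < n)%N ->
    s n = if Num.ceil (n%:R * theta + rho)
             - Num.ceil ((n%:R - 1) * theta + rho) == 0 then a else b.

Definition sturmian (R : realType) (T : Type) (a b : T) (s : nat -> T) : Prop :=
  exists theta rho : R,
    [/\ 0 <= theta <= 1, irrational theta, 0 <= rho < 1
      & lower_mechanical theta rho a b s \/ upper_mechanical theta rho a b s].

(* cfrac a0 [:: a1; ...; an] = [a0; a1, ..., an] *)
Fixpoint cfrac (a0 : int) (s : seq int) : rat :=
  if s is a1 :: s' then a0%:~R + (cfrac a1 s')^-1 else a0%:~R.

(* [0; s_1, s_2, ...] *)
Definition cfrac_word (R : realType) (s : nat -> int) : R :=
  limn (fun n : nat => ratr (cfrac 0 [seq s i | i <- iota 1 n]) : R).

(* x_0 = x and x_(n+1) = 1 / (x_n - floor x_n). For rational x the expansion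
   terminates, and from there on the values below are meaningless, through
   0^-1 = 0. *)
Definition complete_quotient (R : realType) (x : R) (n : nat) : R :=
  iter n (fun y : R => (y - (Num.floor y)%:~R)^-1) x.

Definition partial_quotient (R : realType) (x : R) (n : nat) : int :=
  Num.floor (complete_quotient x n).

Definition convergent (R : realType) (x : R) (n : nat) : rat :=
  cfrac (partial_quotient x 0) [seq partial_quotient x i | i <- iota 1 n].

Definition Q (R : realType) (x : R) (n : nat) : int := denq (convergent x n).

Definition is_levy_constant (R : realType) (x L : R) : Prop :=
  (fun n : nat => n%:R^-1 * ln ((Q x n)%:~R : R)) @ \oo --> L.

Definition has_levy_constant (R : realType) (x : R) : Prop :=
  exists L : R, is_levy_constant x L.

(* Main.v *)
(** Write L n for the logarithm of the continuant of s_1 ... s_n, which is the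
    denominator Q_n. Continuants are multiplicative up to a factor 2, so
    L (n + m) - L n is the logarithm F_m(n) of the continuant of the window
    s_(n+1) ... s_(n+m), up to ln 2. Summing over n < N and telescoping shows
    that m L N / N differs from the Cesaro mean of F_m by at most
    ln 2 + O_m(1/N); hence L N / N is Cauchy once every function of a window of
    bounded length has a Cesaro mean.

    Such a function is a function of the carries
    floor ((n+j) theta + rho) - floor (n theta + rho) - floor (j theta), which
    are 0 or 1. As events in n they form a chain when j varies, so every
    function of finitely many of them is a linear combination of the carries
    and 1; and the mean of a carry exists because its sum telescopes. *)

Require Import Defs.
From HB Require Import structures.
From mathcomp Require Import all_boot all_order all_algebra.
From mathcomp Require Import all_classical all_reals all_analysis.
From mathcomp Require Import zify ring lra.
Import Order.TTheory GRing.Theory Num.Theory.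
Import numFieldNormedType.Exports.
Set Implicit Arguments.
Unset Strict Implicit.
Unset Printing Implicit Defensive.
Local Open Scope classical_set_scope.
Local Open Scope ring_scope.

(** * Continuants and their multiplicativity up to a factor 2 *)

Fixpoint continuant_pair (v : seq int) : int * int :=
  if v is a :: v' then
    let p := continuant_pair v' in (a * p.1 + p.2, p.1)
  else (1, 0).

(** The second component of [continuant_pair] is the continuant of the word without its first letter
    (0 for the empty word); keeping it makes the two-term recursion structural. *)
Definition continuant (v : seq int) : int := (continuant_pair v).1.

Definition positive_word (v : seq int) : bool := all (fun a => 0 < a) v.

Lemma continuant_pair_bounds v : positive_word v ->
  [/\ 0 < (continuant_pair v).1, 0 <= (continuant_pair v).2
    & (continuant_pair v).2 <= (continuant_pair v).1].
Proof.
elim: v => [|a v IH] //= /andP[a0 /IH[h1 h2 h3]].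
by split; nia.
Qed.

Lemma continuant_gt0 v : positive_word v -> 0 < continuant v.
Proof. by case/continuant_pair_bounds. Qed.

Lemma continuant_pair_coprime v :
  coprimez (continuant_pair v).1 (continuant_pair v).2.
Proof.
elim: v => [|a v IH] //=.
by rewrite coprimez_sym /coprimez gcdzMDl.
Qed.

Lemma cfrac_continuant a v : positive_word v ->
  cfrac a v = (continuant (a :: v))%:~R / (continuant v)%:~R.
Proof.
elim: v a => [|b v IH] a /=.
  by move=> _; rewrite /continuant /= divr1 mulr1 addr0.
move=> /andP[b0 hv]; rewrite (IH _ hv) invf_div /continuant /=.
have /continuant_pair_bounds[h1 _ _] : positive_word (b :: v) by rewrite /= b0.
have h2 : 0 < (continuant_pair v).1 by case/continuant_pair_bounds: hv.
rewrite !rmorphD !rmorphM /=.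
have {h1} : (b%:~R * (continuant_pair v).1%:~R + (continuant_pair v).2%:~R : rat) != 0.
  by rewrite -rmorphM -rmorphD /= intr_eq0 gt_eqF.
by move=> h; field.
Qed.

(** With leading letter 0 the numerator is the second component of the pair, which is coprime to the
    first, so the fraction is already in lowest terms. *)
Lemma denq_cfrac0 v : positive_word v -> denq (cfrac 0 v) = continuant v.
Proof.
move=> hv; rewrite cfrac_continuant // {1}/continuant /= mul0r add0r.
rewrite coprimeq_den; last by rewrite coprime_sym; exact: continuant_pair_coprime.
have h := continuant_gt0 hv; rewrite gt_eqF //.
by rewrite gtr0_norm.
Qed.

Lemma continuant_cat_ge u v : positive_word u -> positive_word v ->
  continuant u * continuant v <= continuant (u ++ v).
Proof.
move=> hu hv; rewrite /continuant; case: (continuant_pair_bounds hv).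
set A := (continuant_pair v).1 => h1 h2 h3.
(* For fixed [v] both sides obey the same recursion in [u], with nonnegative coefficients; comparing
   both components at once lets the bound propagate. *)
suff [] : (continuant_pair u).1 * A <= (continuant_pair (u ++ v)).1 /\
   (continuant_pair u).2 * A <= (continuant_pair (u ++ v)).2 by [].
elim: u hu => [|a u IH] /=; first by rewrite mul1r mul0r.
by move=> /andP[a0 /IH[H1 H2]]; split; nia.
Qed.

Lemma continuant_cat_le u v : positive_word u -> positive_word v ->
  continuant (u ++ v) <= 2 * (continuant u * continuant v).
Proof.
move=> hu hv; rewrite /continuant; case: (continuant_pair_bounds hv).
set A := (continuant_pair v).1 => h1 h2 h3.
(* The bound on second components can fail for empty [u], so the induction below starts at
   one-letter words. *)
case: u hu => [|a u]; first by rewrite /=; nia.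
move=> hu.
suff [] : (continuant_pair ((a :: u) ++ v)).1
     <= 2 * ((continuant_pair (a :: u)).1 * A) /\
   (continuant_pair ((a :: u) ++ v)).2
     <= 2 * ((continuant_pair (a :: u)).2 * A) by [].
elim: u a hu => [|b u IH] a /andP[a0 hu].
  by rewrite /= -/A; split; nia.
by have [H1 H2] := IH b hu; move: H1 H2; rewrite /=; split; nia.
Qed.

(** Serves both the logarithms of continuants and the floors behind the carries: with [m] fixed,
    only [m] boundary terms remain however large [N] is. *)
Lemma telescope_shift (V : zmodType) (f : nat -> V) (m N : nat) :
  \sum_(n < N) (f (n + m)%N - f n) = \sum_(i < m) (f (N + i)%N - f i).
Proof.
elim: N => [|N IH]; first by rewrite big_ord0 big1 // => i _; rewrite add0n subrr.
rewrite big_ord_recr /= IH.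
have -> : f (N + m)%N - f N = \sum_(i < m) (f (N + i).+1 - f (N + i)%N).
  rewrite -(big_mkord xpredT (fun i => f (N + i).+1 - f (N + i)%N)).
  have := @telescope_sumr _ 0 m (fun i => f (N + i)%N) isT.
  by rewrite addn0 => <-; apply: eq_bigr => i _; rewrite addnS.
rewrite -big_split /=; apply: eq_bigr => i _.
by rewrite addSn addrC addrA subrK.
Qed.

(** * Cesaro means and almost additive sequences *)

Section CesaroMeans.
Variable R : realType.
Implicit Types (u v : nat -> R) (e : nat -> nat -> bool).

Definition mean u (N : nat) : R := N%:R^-1 * \sum_(n < N) u n.

Lemma mean_cst (c : R) : cvgn (mean (fun=> c)).
Proof.
apply/cvg_ex; exists c.
apply: cvg_near_cst; near=> N.
rewrite /mean sumr_const card_ord -[c *+ N]mulr_natl mulKf // pnatr_eq0 -lt0n.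
by near: N; exact: nbhs_infty_gt.
Unshelve. all: by end_near. Qed.

Lemma meanD u v : cvgn (mean u) -> cvgn (mean v) ->
  cvgn (mean (fun n => u n + v n)).
Proof.
move=> hu hv.
have -> : mean (fun n => u n + v n) = mean u \+ mean v.
  by apply/funext => N; rewrite /mean big_split mulrDr.
exact: is_cvgD.
Qed.

Lemma meanZ (c : R) u : cvgn (mean u) -> cvgn (mean (fun n => c * u n)).
Proof.
move=> hu.
have -> : mean (fun n => c * u n) = (cst c) \* mean u.
  by apply/funext => N; rewrite /mean -mulr_sumr mulrCA.
by apply: is_cvgM => //; exact: is_cvg_cst.
Qed.

Lemma cvg_div_of_bounded (w : nat -> R) (t C : R) :
  (forall N, `|w N - N%:R * t| <= C) ->
  (fun N : nat => N%:R^-1 * w N) @ \oo --> t.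
Proof.
move=> hw; apply/cvgrPdist_lt => eps eps0; near=> N.
have N0 : 0 < N%:R :> R by rewrite ltr0n; near: N; exact: nbhs_infty_gt.
have -> : t - N%:R^-1 * w N = - (N%:R^-1 * (w N - N%:R * t)).
  by field; rewrite gt_eqF.
rewrite normrN normrM gtr0_norm ?invr_gt0 // -ltr_pdivlMl ?invr_gt0 // invrK.
apply: (le_lt_trans (hw N)); rewrite -ltr_pdivrMr //.
by near: N; exact: nbhs_infty_gtr.
Unshelve. all: by end_near. Qed.

(* A chain of events is closed under intersection up to repetition, so the span
   of their indicators is an algebra and sees every function of them. *)
Lemma mean_chain e (m : nat) (G : seq bool -> R) :
  (forall i j, (forall n, e i n -> e j n) \/ (forall n, e j n -> e i n)) ->
  (forall j, cvgn (mean (fun n => (e j n)%:R))) ->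
  cvgn (mean (fun n => G (mkseq (e^~ n) m))).
Proof.
move=> chain e_mean.
(* Convergent means are not stable under products. Asking for convergence also after multiplication
   by each indicator gives a stable class, since a product of two indicators of the chain is one of
   them. *)
pose good u := cvgn (mean u) /\ forall j, cvgn (mean (fun n => u n * (e j n)%:R)).
have goodD u v : good u -> good v -> good (fun n => u n + v n).
  move=> [u1 u2] [v1 v2]; split=> [|j]; first exact: meanD.
  under eq_fun do rewrite mulrDl.
  exact: meanD.
have goodZ c u : good u -> good (fun n => c * u n).
  move=> [u1 u2]; split=> [|j]; first exact: meanZ.
  under eq_fun do rewrite -mulrA.
  exact: meanZ.
have goodM i u : good u -> good (fun n => u n * (e i n)%:R).
  move=> [u1 u2]; split=> [|j]; first exact: u2.
  have [h|h] := chain i j.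
  - under eq_fun => n.
      have -> : u n * (e i n)%:R * (e j n)%:R = u n * (e i n)%:R.
        by have := h n; case: (e i n) => [->//|_]; rewrite ?mulr1 // !mulr0 mul0r.
      over.
    exact: u2.
  - under eq_fun => n.
      have -> : u n * (e i n)%:R * (e j n)%:R = u n * (e j n)%:R.
        by have := h n; case: (e j n) => [->//|_]; rewrite ?mulr1 // !mulr0.
      over.
    exact: u2.
have good1 : good (fun=> 1).
  split=> [|j]; first exact: mean_cst.
  by under eq_fun do rewrite mul1r; exact: e_mean.
have goodW u : good u -> cvgn (mean u) by case.
clearbody good.
suff H : forall u, good u -> good (fun n => u n * G (mkseq (e^~ n) m)).
  by have /goodW := H _ good1; under eq_fun do rewrite mul1r.
elim: m G => [|m IH] G u gu.
  have -> : (fun n => u n * G (mkseq (e^~ n) 0)) = (fun n => G [::] * u n).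
    by apply/funext => n; rewrite mulrC.
  exact: goodZ.
(* Splits [u] as [u e + u (1 - e)] with [e] the last indicator, so that each summand sees [G] with
   its last entry frozen. *)
under eq_fun => n.
  have -> : u n * G (mkseq (e^~ n) m.+1) =
      (u n * (e m n)%:R) * G (rcons (mkseq (e^~ n) m) true) +
      (u n + -1 * (u n * (e m n)%:R)) * G (rcons (mkseq (e^~ n) m) false).
    rewrite mkseqS; case: (e m n).
      by rewrite mulr1 mulN1r subrr mul0r addr0.
    by rewrite mulr0 mul0r mulr0 addr0 add0r.
  over.
have gt := goodM m _ gu.
have gf := goodD _ _ gu (goodZ (-1) _ gt).
exact: goodD (IH (fun w => G (rcons w true)) _ gt)
  (IH (fun w => G (rcons w false)) _ gf).
Qed.

(** After division by [m N] the errors contribute at most [D / m], and the boundary terms vanish as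
    [N] grows; hence [m] is chosen first, to make [D / m < eps / 4]. *)
Lemma almost_additive_cvg (L : nat -> R) (F : nat -> nat -> R) (B D : R) :
  (forall n, `|L n.+1 - L n| <= B) ->
  (forall m n, `|L (n + m)%N - L n - F m n| <= D) ->
  (forall m, cvgn (mean (F m))) ->
  cvgn (fun N : nat => N%:R^-1 * L N).
Proof.
move=> LB LF Fm; apply/cauchy_cvgP/cauchy_exP => eps eps0.
have D0 : 0 <= D by apply: le_trans (LF 0 0)%N.
pose m := (Num.truncn (4 * D / eps)).+1.
have m0 : 0 < m%:R :> R by rewrite ltr0n.
have hm : D < m%:R * (eps / 4).
  have : 4 * D / eps < m%:R by exact: truncnS_gt.
  by rewrite ltr_pdivrMr // => ?; lra.
(* The Cauchy criterion used here asks for one centre per [eps], so the centre may depend on [m]. *)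
pose l := limn (mean (F m)); exists (l / m%:R).
(* Bounds the sum of the boundary terms [L N - L (N + i) + L i], uniformly in [N]. *)
pose C := \sum_(i < m) (i%:R * B + `|L i|).
have LnB n i : `|L (n + i)%N - L n| <= i%:R * B.
  elim: i => [|i IH]; first by rewrite addn0 subrr normr0 mul0r.
  rewrite addnS -(subrK (L (n + i)%N) (L (n + i).+1)) -addrA -natr1 mulrDl mul1r addrC.
  by apply: (le_trans (ler_normD _ _)); apply: lerD.
have key N : `|m%:R * L N - \sum_(n < N) F m n| <= C + N%:R * D.
  have -> : m%:R * L N - \sum_(n < N) F m n =
      \sum_(i < m) (L N - L (N + i)%N + L i)
      + \sum_(n < N) (L (n + m)%N - L n - F m n).
    rewrite sumrB telescope_shift addrA -big_split /=; congr (_ - _).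
    rewrite (eq_bigr (fun=> L N)) => [|i _]; last by ring.
    by rewrite sumr_const card_ord mulr_natl.
  apply: (le_trans (ler_normD _ _)); apply: lerD.
    apply: (le_trans (ler_norm_sum _ _ _)); apply: ler_sum => i _.
    by apply: (le_trans (ler_normD _ _)); rewrite lerD2r distrC.
  apply: (le_trans (ler_norm_sum _ _ _)).
  apply: (@le_trans _ _ (\sum_(n < N) D)); first by apply: ler_sum => n _; exact: LF.
  by rewrite sumr_const card_ord mulr_natl.
change (\forall N \near \oo, `|l / m%:R - N%:R^-1 * L N| < eps); near=> N.
have N0 : 0 < N%:R :> R by rewrite ltr0n; near: N; exact: nbhs_infty_gt.
have hC : C < N%:R * (m%:R * (eps / 4)).
  rewrite -ltr_pdivrMr ?mulr_gt0 ?divr_gt0 //.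
  by near: N; exact: nbhs_infty_gtr.
have hl : `|l - mean (F m) N| < m%:R * (eps / 4).
  by near: N; apply: (cvgr_dist_lt _ _ (Fm m)); rewrite mulr_gt0 // divr_gt0.
have -> : l / m%:R - N%:R^-1 * L N = m%:R^-1 * (l - mean (F m) N)
   - (N%:R * m%:R)^-1 * (m%:R * L N - \sum_(n < N) F m n).
  by rewrite /mean; field; rewrite !gt_eqF.
apply: (le_lt_trans (ler_normB _ _)).
rewrite !normrM !(gtr0_norm (x := _^-1)) ?invr_gt0 ?mulr_gt0 //.
have h1 : m%:R^-1 * `|l - mean (F m) N| < eps / 4 by rewrite ltr_pdivrMl.
have h2 : (N%:R * m%:R)^-1 * `|m%:R * L N - \sum_(n < N) F m n| < eps / 2.
  rewrite ltr_pdivrMl ?mulr_gt0 //; apply: (le_lt_trans (key N)).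
  have : N%:R * D < N%:R * (m%:R * (eps / 4)) by rewrite ltr_pM2l.
  by lra.
by lra.
Unshelve. all: by end_near. Qed.

End CesaroMeans.

(** * Carries and window means of mechanical words *)

Section MechanicalWords.
Variable R : realType.
Implicit Types (x y theta rho : R).

Definition frac_part x : R := x - (Num.floor x)%:~R.

Lemma frac_part_itv x : 0 <= frac_part x < 1.
Proof.
have := floor_itv x; rewrite intrD /frac_part => /andP[h1 h2].
by rewrite subr_ge0 h1 ltrBlDl.
Qed.

Lemma floorD_carry x y :
  Num.floor (x + y) =
    Num.floor x + Num.floor y + (1 <= frac_part x + frac_part y)%R%:Z.
Proof.
have := frac_part_itv x; have := frac_part_itv y.
rewrite /frac_part => /andP[y0 y1] /andP[x0 x1].
apply: floor_def; rewrite !intrD.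
by case: (lerP 1) => h /=; apply/andP; split; lra.
Qed.

(* The carry occurs exactly when the fractional part of n theta + rho is at
   least one minus that of j theta, so these events form a chain as j varies. *)
Definition carry theta rho (j n : nat) : bool :=
  1 <= frac_part (n%:R * theta + rho) + frac_part (j%:R * theta).

Lemma carryE theta rho j n :
  Num.floor ((n + j)%:R * theta + rho) =
  Num.floor (n%:R * theta + rho) + Num.floor (j%:R * theta)
  + (carry theta rho j n)%:Z.
Proof. by rewrite natrD mulrDl addrAC floorD_carry. Qed.

Lemma carry_chain theta rho i j :
  (forall n, carry theta rho i n -> carry theta rho j n) \/
  (forall n, carry theta rho j n -> carry theta rho i n).
Proof.
have [h|h] := leP (frac_part (i%:R * theta)) (frac_part (j%:R * theta)).
- by left=> n; rewrite /carry => /le_trans; apply; rewrite lerD2l.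
- by right=> n; rewrite /carry => /le_trans; apply; rewrite lerD2l ltW.
Qed.

(** Up to the constant [floor (j theta)], a carry is an increment of [c] over distance [j].
    Telescoping leaves [j] differences [c (N + i) - c i], each within 1 of [N theta]; this gives the
    bound [j] and the limit. *)
Lemma mean_carry theta rho j : cvgn (mean (fun n => (carry theta rho j n)%:R : R)).
Proof.
pose c n : R := (Num.floor (n%:R * theta + rho))%:~R.
apply/cvg_ex; exists (frac_part (j%:R * theta)).
apply: (@cvg_div_of_bounded _ _ _ j%:R) => N.
have -> : \sum_(n < N) (carry theta rho j n)%:R - N%:R * frac_part (j%:R * theta)
    = \sum_(i < j) (c (N + i)%N - c i - N%:R * theta).
  rewrite sumrB -telescope_shift sumr_const card_ord -[(N%:R * theta) *+ j]mulr_natl.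
  rewrite [in RHS](eq_bigr (fun n : 'I_N =>
    (carry theta rho j n)%:R + (Num.floor (j%:R * theta))%:~R)) => [|n _]; last first.
    by rewrite /c carryE !intrD; ring.
  rewrite big_split /= sumr_const card_ord -[_%:~R *+ N]mulr_natl /frac_part.
  by ring.
apply: (le_trans (ler_norm_sum _ _ _)).
apply: (@le_trans _ _ (\sum_(i < j) 1)); last by rewrite sumr_const card_ord.
apply: ler_sum => i _; rewrite ler_norml /c natrD.
have := floor_itv (i%:R * theta + rho).
have := floor_itv ((N%:R + i%:R) * theta + rho).
rewrite !intrD => /andP[h1 h2] /andP[h3 h4].
by apply/andP; split; lra.
Qed.

(** In the difference of consecutive floors the term [floor (n theta + rho)] cancels, leaving two
    carries and constants independent of [n]. A window of [m] letters thus depends on the [m + 1]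
    carries with [j] from 0 to [m]. *)
Lemma mean_mechanical_window (T : Type) theta rho (a b : T) s (m : nat)
    (G : seq T -> R) :
  lower_mechanical theta rho a b s ->
  cvgn (mean (fun n => G [seq s k | k <- iota n.+1 m])).
Proof.
move=> hs; pose p (i : nat) := Num.floor (i%:R * theta).
pose letter (w : seq bool) i :=
  if (nth false w i.+1)%:Z + p i.+1 - ((nth false w i)%:Z + p i) == 0
  then a else b.
have -> : (fun n => G [seq s k | k <- iota n.+1 m]) = (fun n =>
    G [seq letter (mkseq ((carry theta rho)^~ n) m.+1) i | i <- iota 0 m]).
  apply/funext => n; congr G.
  rewrite -[in LHS](addn0 n.+1) iotaDl -map_comp.
  apply/eq_in_map => i; rewrite mem_iota /= add0n => im.
  rewrite addSn hs // -natr1 addrK natr1 /letter.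
  rewrite !nth_mkseq ?ltnS //; last exact: ltnW.
  rewrite -addnS !carryE -/(p _) -/(p _); congr (if _ == 0 then _ else _).
  by ring.
exact: (@mean_chain R _ m.+1 (fun w => G [seq letter w i | i <- iota 0 m])
  (carry_chain theta rho) (@mean_carry theta rho)).
Qed.

(** Ceilings are negated floors of the opposite, and the test against 0 ignores signs. The slope may
    become negative, so the window lemma covers all real [theta] and [rho]. *)
Lemma upper_mechanical_lower (T : Type) theta rho (a b : T) s :
  upper_mechanical theta rho a b s ->
  lower_mechanical (- theta) (- rho) a b s.
Proof.
by move=> hs n n0; rewrite hs // !ceilNfloor !mulrN -!opprD oppr_eq0.
Qed.

End MechanicalWords.

(** * Growth of continuants along a bounded word *)

Section ContinuantGrowth.
Variables (R : realType).

Lemma ln_continuant_cat u v : positive_word u -> positive_word v ->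
  `|ln (continuant (u ++ v))%:~R - ln (continuant u)%:~R
    - ln (continuant v)%:~R| <= ln 2 :> R.
Proof.
move=> hu hv.
have u0 := continuant_gt0 hu; have v0 := continuant_gt0 hv.
have uR : 0 < (continuant u)%:~R :> R by rewrite ltr0z.
have vR : 0 < (continuant v)%:~R :> R by rewrite ltr0z.
have h1 := continuant_cat_ge hu hv; have h2 := continuant_cat_le hu hv.
have w0 : 0 < (continuant (u ++ v))%:~R :> R.
  by rewrite ltr0z; apply: lt_le_trans h1; rewrite mulr_gt0.
have l1 : ln (continuant u)%:~R + ln (continuant v)%:~R
    <= ln (continuant (u ++ v))%:~R :> R.
  by rewrite -lnM ?posrE // ler_ln ?posrE ?mulr_gt0 // -intrM ler_int.
have l2 : ln (continuant (u ++ v))%:~R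
    <= ln 2 + (ln (continuant u)%:~R + ln (continuant v)%:~R) :> R.
  rewrite -lnM ?posrE // -lnM ?posrE ?mulr_gt0 //.
  rewrite ler_ln ?posrE ?mulr_gt0 //.
  by rewrite -[2]/(2%:~R) -!intrM ler_int.
by rewrite ler_norml; apply/andP; split; have := ln_ge0 (ler1n R 2); lra.
Qed.

Lemma continuant_growth_cvg (s : nat -> int) (M : int) :
  (forall n, (0 < n)%N -> 0 < s n <= M) ->
  (forall m (G : seq int -> R),
    cvgn (mean (fun n => G [seq s k | k <- iota n.+1 m]))) ->
  cvgn (fun N : nat => N%:R^-1 * ln (continuant [seq s k | k <- iota 1 N])%:~R : R).
Proof.
move=> sM hG; pose L N : R := ln (continuant [seq s k | k <- iota 1 N])%:~R.
pose F m n : R := ln (continuant [seq s k | k <- iota n.+1 m])%:~R.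
have pos n m : positive_word [seq s k | k <- iota n.+1 m].
  apply/allP => _ /mapP[k + ->]; rewrite mem_iota => /andP[nk _].
  by case/andP: (sM k (leq_ltn_trans (leq0n _) nk)).
have LF m n : `|L (n + m)%N - L n - F m n| <= ln 2.
  by rewrite /L iotaD map_cat; exact: ln_continuant_cat.
(* A one-letter window has its letter, at most [M], as continuant. *)
have LB n : `|L n.+1 - L n| <= ln 2 + ln M%:~R.
  have := LF 1%N n; rewrite addn1 => h.
  rewrite -(subrK (F 1%N n) (L n.+1 - L n)).
  apply: (le_trans (ler_normD _ _)); apply: lerD => //.
  have /andP[h0 h1] := sM n.+1 isT.
  have -> : F 1%N n = ln (s n.+1)%:~R by rewrite /F /continuant /= mulr1 addr0.
  rewrite ger0_norm; last by rewrite ln_ge0 // ler1z.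
  by rewrite ler_ln ?posrE ?ltr0z ?ler_int // (lt_le_trans h0).
by apply: (almost_additive_cvg LB LF) => m; exact: (hG m (fun w => ln (continuant w)%:~R)).
Qed.

End ContinuantGrowth.

(** * Convergence of the infinite continued fraction and recovery of its digits *)

Section Convergence.
Variables (R : realType).
Implicit Types (s : nat -> int) (M : int).

Definition tail_convergent s (k n : nat) : R :=
  ratr (cfrac (s k) [seq s i | i <- iota k.+1 n]).

Definition tail_value s (k : nat) : R := limn (tail_convergent s k).

Lemma tail_convergentS s k n :
  tail_convergent s k n.+1 = (s k)%:~R + (tail_convergent s k.+1 n)^-1.
Proof. by rewrite /tail_convergent /= rmorphD /= ratr_int fmorphV. Qed.

Lemma tail_convergent_bounds s M k n : (forall n, (0 < n)%N -> 0 < s n <= M) ->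
  (0 < k)%N -> 1 <= tail_convergent s k n <= M%:~R + 1.
Proof.
move=> sM; have bnd j : (0 < j)%N -> 1 <= (s j)%:~R :> R /\ (s j)%:~R <= M%:~R :> R.
  by move=> /sM /andP[h0 h1]; rewrite ler1z ler_int.
elim: n k => [|n IH] k k0; have [h1 h2] := bnd k k0.
  by rewrite /tail_convergent /= ratr_int h1 /= (le_trans h2) // lerDl.
have /andP[h3 h4] := IH k.+1 isT; rewrite tail_convergentS.
have h5 : 0 < (tail_convergent s k.+1 n)^-1 by rewrite invr_gt0; lra.
have h6 : (tail_convergent s k.+1 n)^-1 <= 1 by rewrite invf_le1 //; lra.
by apply/andP; split; lra.
Qed.

(** The margin above 1 is uniform in [k] and [n]: it makes inversion a contraction and survives
    passage to the limit. *)
Lemma tail_convergent_gt1 s M k n : (forall n, (0 < n)%N -> 0 < s n <= M) ->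
  (0 < k)%N -> 1 + (M%:~R + 1)^-1 <= tail_convergent s k n.+1.
Proof.
move=> sM k0; rewrite tail_convergentS.
have /andP[h1 h2] := tail_convergent_bounds n sM (ltn0Sn k).
have /andP[h3 h4] := sM k k0.
apply: lerD; first by rewrite ler1z.
by rewrite lef_pV2 // posrE; lra.
Qed.

(** Inversion divides a distance by [x y], which is at least [1 + (M + 1)^-1], so each common letter
    gains a geometric factor. The initial [M] is the length of the interval [[1, M + 1]]. *)
Lemma tail_convergent_dist s M k n m : (forall n, (0 < n)%N -> 0 < s n <= M) ->
  (0 < k)%N ->
  `|tail_convergent s k n.+1 - tail_convergent s k (n + m).+1|
    <= M%:~R * (1 + (M%:~R + 1)^-1)^-1 ^+ n.
Proof.
move=> sM; set r := (1 + _)^-1.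
have M0 : 0 < M%:~R :> R.
  by rewrite ltr0z; have /andP[/lt_le_trans] := sM 1%N isT; apply.
have d0 : 0 < (M%:~R + 1)^-1 :> R by rewrite invr_gt0; lra.
elim: n k => [|n IH] k k0.
  rewrite add0n expr0 mulr1 ler_norml.
  have /andP[h1 h2] := tail_convergent_bounds 1 sM k0.
  have /andP[h3 h4] := tail_convergent_bounds m.+1 sM k0.
  by apply/andP; split; lra.
rewrite addSn !(tail_convergentS s k).
have := IH k.+1 isT.
have := tail_convergent_gt1 n sM (ltn0Sn k).
have := tail_convergent_gt1 (n + m) sM (ltn0Sn k).
set x := tail_convergent s k.+1 n.+1; set y := tail_convergent s k.+1 (n + m).+1.
clearbody x y => hy hx hxy.
have x0 : 0 < x by lra.
have y0 : 0 < y by lra.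
have -> : (s k)%:~R + x^-1 - ((s k)%:~R + y^-1) = - ((x * y)^-1 * (x - y)).
  by field; rewrite !gt_eqF.
rewrite normrN normrM gtr0_norm ?invr_gt0 ?mulr_gt0 // exprSr mulrA.
rewrite [leRHS]mulrC; apply: ler_pM => //; first by rewrite invr_ge0 mulr_ge0 // ltW.
rewrite lef_pV2 ?posrE ?mulr_gt0 //; last by lra.
by nra.
Qed.

Lemma cvg_tail_convergent s M k : (forall n, (0 < n)%N -> 0 < s n <= M) ->
  (0 < k)%N -> tail_convergent s k @ \oo --> tail_value s k.
Proof.
move=> sM k0; apply/cauchy_cvgP/cauchy_exP => eps eps0.
set r := (1 + (M%:~R + 1)^-1)^-1 : R.
have M0 : 0 < M%:~R :> R.
  by rewrite ltr0z; have /andP[/lt_le_trans] := sM 1%N isT; apply.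
have d0 : 0 < (M%:~R + 1)^-1 :> R by rewrite invr_gt0; lra.
have r1 : `|r| < 1.
  by rewrite gtr0_norm ?invr_gt0 ?invf_lt1 //; lra.
have [n _ /(_ n (leqnn n)) hn] := cvgr_dist_lt _ _ (cvg_geometric M%:~R r1) _ eps0.
exists (tail_convergent s k n.+1).
exists n.+1 => // N /= nN; rewrite /ball /=.
have -> : N = (n + (N - n.+1)).+1 by rewrite -addSn subnKC.
apply: (le_lt_trans (tail_convergent_dist _ _ sM k0)).
move: hn; rewrite /= sub0r normrN; apply: le_lt_trans.
exact: ler_norm.
Qed.

Lemma tail_value_gt1 s M k : (forall n, (0 < n)%N -> 0 < s n <= M) ->
  (0 < k)%N -> 1 < tail_value s k.
Proof.
move=> sM k0.
have M0 : 0 < M%:~R :> R.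
  by rewrite ltr0z; have /andP[/lt_le_trans] := sM 1%N isT; apply.
apply: (@lt_le_trans _ _ (1 + (M%:~R + 1)^-1)).
  by rewrite ltrDl invr_gt0 addr_gt0.
apply: limr_ge; first exact: (cvg_tail_convergent sM k0).
exists 1%N => // -[|n] //= _; exact: (tail_convergent_gt1 _ sM).
Qed.

(** Only the tail from [k.+1] is inverted, so [k = 0] is allowed although [s 0] is unconstrained. *)
Lemma tail_valueS s M k : (forall n, (0 < n)%N -> 0 < s n <= M) ->
  tail_value s k = (s k)%:~R + (tail_value s k.+1)^-1.
Proof.
move=> sM; apply/cvg_lim => //; rewrite -cvg_shiftS.
under eq_cvg do rewrite /= tail_convergentS.
apply: cvgD; first exact: cvg_cst.
apply: cvgV; last exact: (cvg_tail_convergent sM).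
by have := tail_value_gt1 sM (ltn0Sn k) => h; rewrite gt_eqF //; lra.
Qed.

Lemma floor_tail_value s M k : (forall n, (0 < n)%N -> 0 < s n <= M) ->
  Num.floor (tail_value s k) = s k.
Proof.
move=> sM; rewrite (tail_valueS _ sM).
have h := tail_value_gt1 sM (ltn0Sn k).
have h0 : 0 < (tail_value s k.+1)^-1 by rewrite invr_gt0; lra.
have h1 : (tail_value s k.+1)^-1 < 1 by rewrite invf_lt1 //; lra.
by apply: floor_def; rewrite intrD; apply/andP; split; lra.
Qed.

Lemma complete_quotient_tail s M k : (forall n, (0 < n)%N -> 0 < s n <= M) ->
  complete_quotient (tail_value s 0) k = tail_value s k.
Proof.
move=> sM; elim: k => [|k IH] //.
rewrite /complete_quotient iterS -/(complete_quotient _ k) IH (floor_tail_value _ sM).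
by rewrite {1}(tail_valueS _ sM) addrC addKr invrK.
Qed.

Lemma Q_tail_value s M n : (forall n, (0 < n)%N -> 0 < s n <= M) ->
  s 0%N = 0 -> Q (tail_value s 0) n = continuant [seq s i | i <- iota 1 n].
Proof.
move=> sM s0; rewrite /Q /convergent /partial_quotient.
rewrite (complete_quotient_tail _ sM) (floor_tail_value _ sM) s0.
rewrite (eq_map (g := s)) => [|i]; last first.
  by rewrite (complete_quotient_tail _ sM) (floor_tail_value _ sM).
apply: denq_cfrac0; apply/allP => _ /mapP[k + ->].
by rewrite mem_iota => /andP[k0 _]; case/andP: (sM k k0).
Qed.

End Convergence.

Theorem theorem2p4 (R : realType) (a b : int) (s : nat -> int) (alpha : R) :
  0 < a -> 0 < b -> a <> b ->
  sturmian R a b s ->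
  alpha = cfrac_word R s ->
  has_levy_constant alpha.
Proof.
move=> a0 b0 _ [theta [rho [_ _ _ hs]]] ->.
have {theta rho hs} [theta [rho hs]] :
    exists theta rho : R, lower_mechanical theta rho a b s.
  case: hs => h; first by exists theta, rho.
  by exists (- theta), (- rho); exact: upper_mechanical_lower.
(* The value of [s] at 0 is arbitrary; it is replaced by the integer part 0 of [alpha], so that
   [alpha] is the tail value at index 0. *)
pose s0 n := if n is 0%N then 0 else s n.
have sM n : (0 < n)%N -> 0 < s0 n <= Num.max a b.
  case: n => // n _; rewrite /s0 hs //.
  by case: ifP => _; rewrite ?a0 ?b0 le_max lexx ?orbT.
have s0E n m : [seq s0 k | k <- iota n.+1 m] = [seq s k | k <- iota n.+1 m].
  by apply/eq_in_map => k; rewrite mem_iota; case: k.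
have -> : cfrac_word R s = tail_value R s0 0.
  rewrite /cfrac_word /tail_value; congr (limn _).
  by apply/funext => n; rewrite /tail_convergent s0E.
have /cvg_ex[l hl] : cvgn (fun N : nat =>
    N%:R^-1 * ln (continuant [seq s0 k | k <- iota 1 N])%:~R : R).
  apply: (continuant_growth_cvg sM) => m G.
  under eq_fun do rewrite s0E.
  exact: mean_mechanical_window hs.
exists l; rewrite /is_levy_constant.
by under eq_fun do rewrite (Q_tail_value R _ sM (erefl 0)).
Qed.
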